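(* For every integer $n\ge1$, $$2^n(1+x^2)\hat{A}_n(x)=(1-x)^{n+1}P_n\!\left(\frac{1+x}{1-x}\right),\qquad \hat{B}_n(x)=(1-x)^nQ_n\!\left(\frac{1+x}{1-x}\right).$$
   Context: For $\sigma\in\mathfrak S_n$ (permutations of $[n]$), $i\in[n-1]$ is an alternating descent if either $\sigma(i)>\sigma(i+1)$ and $i$ is odd, or $\sigma(i)<\sigma(i+1)$ and $i$ is even; $\hat A_n(x)=\sum_{\sigma\in\mathfrak S_n}x^{\hat d(\sigma)}$ where $\hat d(\sigma)$ is the number of alternating descents. $\mathcal B_n$ is the set of signed permutations: bijections $\pi$ of $\{\pm1,\dots,\pm n\}$ with $\pi(-i)=-\pi(i)$, written as words $\pi(1)\cdots\pi(n)$ with $\pi(0)=0$. An index $i\in\{0\}\cup[n-1]$ is an alternating descent of $\pi$ if either $\pi(i)<\pi(i+1)$ and $i$ even, or $\pi(i)>\pi(i+1)$ and $i$ odd; $\hat B_n(x)=\sum_{\pi\in\mathcal B_n}x^{\hat d_B(\pi)}$ with $\hat d_B(\pi)$ the number of such indices. $P_n,Q_n$ are Hoffman's derivative polynomials, defined by $\frac{d^n}{dt^n}\tan t=P_n(\tan t)$ and $\frac{d^n}{dt^n}\sec t=Q_n(\tan t)\sec t$; equivalently $P_0(x)=x$, $Q_0(x)=1$, $P_{n+1}(x)=(1+x^2)P_n'(x)$, $Q_{n+1}(x)=xQ_n(x)+(1+x^2)Q_n'(x)$. *)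

(* Defs.v *)
From HB Require Import structures.
From mathcomp Require Import all_boot all_order all_algebra all_fingroup.
Set Implicit Arguments. Unset Strict Implicit. Unset Printing Implicit Defensive.
Import Order.TTheory GRing.Theory Num.Theory.

(* one-line notation of s : 'S_n as the word s(1) ... s(n); we use values
   0..n-1 (shift by one does not affect comparisons).  Entry j (0-based)
   of the word is sigma(j+1). *)
Definition perm_word (n : nat) (s : 'S_n) : seq nat :=
  [seq val (s i) | i <- enum 'I_n].

(* number of alternating descents: 1-based positions i in [n-1] with
   (sigma(i) > sigma(i+1) and i odd) or (sigma(i) < sigma(i+1) and i even).
   Position i (1-based) corresponds to word entries i-1 and i. *)
Definition altdes (n : nat) (s : 'S_n) : nat :=
  let w := perm_word s in
  \sum_(1 <= i < n)
     (((nth 0 w i.-1 > nth 0 w i) && odd i)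
      || ((nth 0 w i.-1 < nth 0 w i) && ~~ odd i))%N.

Local Open Scope ring_scope.

Definition hatA (R : nzRingType) (n : nat) : {poly R} :=
  \sum_(s : 'S_n) 'X^(altdes s).

(* A signed permutation pi of {+-1,...,+-n} (pi(-i) = -pi(i)) is encoded by
   the pair (s, e) with s : 'S_n and e : sign vector, via
   pi(i) = (-1)^(e i) * (s(i-1) + 1)  for i = 1..n (0-based index i-1).
   This is the standard bijection between B_n and S_n x {+-1}^n. *)
Definition signed_perm (n : nat) : finType := ('S_n * {ffun 'I_n -> bool})%type.

(* The word pi(0) pi(1) ... pi(n) with pi(0) = 0, as integers. *)
Definition sperm_word (n : nat) (p : signed_perm n) : seq int :=
  0%R :: [seq (if p.2 i then - ((val (p.1 i)).+1)%:Z else ((val (p.1 i)).+1)%:Z)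
          | i <- enum 'I_n].

Definition altdesB_at (w : seq int) (i : nat) : bool :=
  ((nth 0 w i < nth 0 w i.+1) && ~~ odd i)
  || ((nth 0 w i > nth 0 w i.+1) && odd i).

Definition altdesB (n : nat) (p : signed_perm n) : nat :=
  (\sum_(0 <= i < n) altdesB_at (sperm_word p) i)%N.

Definition hatB (R : nzRingType) (n : nat) : {poly R} :=
  \sum_(p : signed_perm n) 'X^(altdesB p).

Fixpoint hoffP (R : nzRingType) (n : nat) : {poly R} :=
  match n with
  | 0 => 'X
  | m.+1 => (1 + 'X ^+ 2) * (hoffP R m)^`()
  end.

Fixpoint hoffQ (R : nzRingType) (n : nat) : {poly R} :=
  match n with
  | 0 => 1
  | m.+1 => 'X * hoffQ R m + (1 + 'X ^+ 2) * (hoffQ R m)^`()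
  end.

(* Main.v *)
Require Import Defs.
From HB Require Import structures.
From mathcomp Require Import all_boot all_order all_algebra all_fingroup.
From mathcomp Require Import ring zify.
Import Order.TTheory GRing.Theory Num.Theory.
Local Open Scope ring_scope.

(* Let C_b[n] be the generating polynomial, over signed permutations of [n], of
   the alternating descents at the indices b, ..., n-1; thus C_0 is hatB.
   Insert +-(n+1) at any slot and negate everything to its right: every signed
   permutation of [n+1] arises exactly once.  Negating the tail compensates the
   parity shift of its positions, so an insertion at an inner slot k forgets
   whether k was an alternating descent and creates 0 or 2 new ones according
   to the sign, while an insertion at an end slot creates 0 or 1.  Hence
     C_b[n+1] = (1+x^2) ((1-x) C_b[n]' + (n-b) C_b[n]) + (b+1) (1+x) C_b[n],
   which under y = (1+x)/(1-x) becomes Hoffman's recurrence for Q_n when b = 0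
   and, after multiplication by 1+x^2, for P_n when b = 1.  Finally
   C_1 = 2^n hatA: for each choice of the set of negative values, the words
   have the same order patterns as the permutations of [n]. *)

Set Implicit Arguments.
Unset Strict Implicit.

(** * Inserting a letter of largest absolute value *)

Definition altdes_from (b m : nat) (w : seq int) : nat :=
  (\sum_(b <= i < m) altdesB_at w i)%N.

Definition signed_val (n : nat) (p : signed_perm n) (i : 'I_n) : int :=
  if p.2 i then - ((val (p.1 i)).+1)%:Z else ((val (p.1 i)).+1)%:Z.

Lemma nth_sperm_word n (p : signed_perm n) (i : 'I_n) :
  nth 0 (sperm_word p) i.+1 = signed_val p i.
Proof. by rewrite /= (nth_map i) ?size_enum_ord // nth_ord_enum. Qed.

Lemma sperm_word_bound n (p : signed_perm n) j : (j <= n)%N ->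
  - n.+1%:Z < nth 0 (sperm_word p) j < n.+1%:Z.
Proof.
case: j => [|j] ltjn; first by rewrite /=; lia.
rewrite (nth_sperm_word _ (Ordinal ltjn)) /signed_val.
by have := ltn_ord (p.1 (Ordinal ltjn)); case: (p.2 _) => /=; lia.
Qed.

Definition insert_max (n : nat) (t : 'I_n.+1 * bool * signed_perm n) :
    signed_perm n.+1 :=
  (lift_perm t.1.1 ord_max t.2.1,
   [ffun j => if unlift t.1.1 j is Some i then t.2.2 i (+) (t.1.1 <= i)%N
              else t.1.2]).

(** The cardinalities agree, so injectivity suffices; the slot is recovered as the position of the
    maximal value. *)
Lemma insert_max_bij n : bijective (@insert_max n).
Proof.
apply: inj_card_bij; last first.
  rewrite !card_prod !card_ffun !card_ord !card_bool !card_Sn factS expnS.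
  by rewrite leq_eqVlt; apply/orP; left; apply/eqP; ring.
case=> [[k a] [s e]] [[l b] [t f]] [/= eq_st eq_ef].
have eq_kl: k = l.
  by apply: (@perm_inj _ (lift_perm k ord_max s));
    rewrite lift_perm_id eq_st lift_perm_id.
subst l; have /ffunP eqf := eq_ef; congr (_, _, (_, _)).
- by have := eqf k; rewrite !ffunE unlift_none.
- apply/permP=> i; apply: (@lift_inj _ ord_max).
  by rewrite -!(lift_perm_lift k) eq_st.
- by apply/ffunP=> i; have := eqf (lift k i); rewrite !ffunE liftK; apply: addIb.
Qed.

Section InsertWord.
Variables (n : nat) (k : 'I_n.+1) (a : bool) (p : signed_perm n).
Let q := insert_max (k, a, p).

Lemma insert_max_lift (i : 'I_n) :
  signed_val q (lift k i) = (-1) ^+ (k <= i)%N * signed_val p i.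
Proof.
rewrite /signed_val /= ffunE liftK lift_perm_lift lift_max.
by case: (p.2 i); case: (k <= i)%N => /=; rewrite ?expr0 ?expr1; ring.
Qed.

Lemma nth_insert_max_le j : (j <= k)%N ->
  nth 0 (sperm_word q) j = nth 0 (sperm_word p) j.
Proof.
case: j => [|j] // ltjk.
have ltjn : (j < n)%N by have := ltn_ord k; lia.
have ej : j = lift k (Ordinal ltjn) by rewrite /= /bump leqNgt ltjk.
rewrite [X in _ X.+1 = _]ej nth_sperm_word insert_max_lift.
by rewrite (nth_sperm_word p (Ordinal ltjn)) /= leqNgt ltjk /= mul1r.
Qed.

Lemma nth_insert_max_eq :
  nth 0 (sperm_word q) k.+1 = if a then - n.+1%:Z else n.+1%:Z.
Proof. by rewrite nth_sperm_word /signed_val /= ffunE unlift_none lift_perm_id. Qed.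

Lemma nth_insert_max_gt j : (k < j <= n)%N ->
  nth 0 (sperm_word q) j.+1 = - nth 0 (sperm_word p) j.
Proof.
case: j => [|j] //; rewrite ltnS => /andP[lekj ltjn].
have ej : j.+1 = lift k (Ordinal ltjn) by rewrite /= /bump lekj.
rewrite [X in _ X.+1 = _]ej nth_sperm_word insert_max_lift.
by rewrite (nth_sperm_word p (Ordinal ltjn)) /= lekj mulN1r.
Qed.

Lemma altdesB_at_insert_lt i : (i < k)%N ->
  altdesB_at (sperm_word q) i = altdesB_at (sperm_word p) i.
Proof. by move=> ltik; rewrite /altdesB_at !nth_insert_max_le // ltnW. Qed.

(** The new letter exceeds its neighbour in absolute value, so its sign alone decides the
    comparison. *)
Lemma altdesB_at_insert_left : altdesB_at (sperm_word q) k = a (+) ~~ odd k.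
Proof.
rewrite /altdesB_at nth_insert_max_eq nth_insert_max_le //.
have := @sperm_word_bound _ p k (leq_ord k).
by case: a => /=; case: (odd k) => /=; lia.
Qed.

(** Compared with the left neighbour, both the direction of the comparison and the parity of the
    index change, so the two new indices agree. *)
Lemma altdesB_at_insert_right : (k < n)%N ->
  altdesB_at (sperm_word q) k.+1 = a (+) ~~ odd k.
Proof.
move=> ltkn; rewrite /altdesB_at nth_insert_max_eq nth_insert_max_gt ?ltnSn //.
have := @sperm_word_bound _ p k.+1 ltkn.
by case: a => /=; case: (odd k) => /=; lia.
Qed.

(* Shifting the tail by one position exchanges the roles of ascents and
   descents; negating it exchanges them back. *)
Lemma altdesB_at_insert_gt i : (k < i < n)%N ->
  altdesB_at (sperm_word q) i.+1 = altdesB_at (sperm_word p) i.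
Proof.
by move=> lt_kin; rewrite /altdesB_at !nth_insert_max_gt; lia.
Qed.

Lemma altdes_insert_last b : (b <= n)%N -> k = n :> nat ->
  altdes_from b n.+1 (sperm_word q) =
    (altdes_from b n (sperm_word p) + (a (+) ~~ odd k))%N.
Proof.
move=> lebn ekn; rewrite /altdes_from big_nat_recr //= -altdesB_at_insert_left ekn.
congr addn.
by apply: eq_big_nat => i /andP[_ ltin]; rewrite altdesB_at_insert_lt ?ekn.
Qed.

(** Index 0 lies outside the range, so only the right-hand side of the new letter contributes. *)
Lemma altdes_insert_first : (k < n)%N -> k = 0 :> nat ->
  altdes_from 1 n.+1 (sperm_word q) =
    (altdes_from 1 n (sperm_word p) + (a (+) ~~ odd k))%N.
Proof.
move=> ltkn ek0; rewrite -altdesB_at_insert_right // ek0 /altdes_from.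
rewrite big_ltn; last lia.
rewrite big_add1 /= addnC; congr addn.
by apply: eq_big_nat => i lt_in; rewrite altdesB_at_insert_gt ?ek0.
Qed.

Lemma altdes_insert_mid b : (b <= k < n)%N ->
  altdes_from b n.+1 (sperm_word q) =
    (altdes_from b n (sperm_word p) - altdesB_at (sperm_word p) k
     + (a (+) ~~ odd k).*2)%N.
Proof.
case/andP=> lebk ltkn; rewrite /altdes_from.
have split_at m (F : nat -> nat) : (k < m)%N -> (\sum_(b <= i < m) F i =
    \sum_(b <= i < k) F i + (F k + \sum_(k.+1 <= i < m) F i))%N.
  move=> ltkm; rewrite (@big_cat_nat _ _ _ k) //=; last lia.
  by congr addn; rewrite big_ltn.
rewrite (split_at n.+1) 1?ltnW // (split_at n) // [X in (_ + (_ + X))%N = _]big_ltn ?ltnS //.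
rewrite big_add1 /= altdesB_at_insert_left altdesB_at_insert_right //.
rewrite (eq_big_nat _ _ (F2 := fun i => altdesB_at (sperm_word p) i : nat)); last first.
  by move=> i /andP[_ ltik]; rewrite altdesB_at_insert_lt.
rewrite [X in (_ + (_ + (_ + X)))%N](eq_big_nat _ _
  (F2 := fun i => altdesB_at (sperm_word p) i : nat)); last first.
  by move=> i lt_kin; rewrite altdesB_at_insert_gt.
(* The truncated subtraction is exact: index [k] lies in the range and is one of the summands. *)
by rewrite -addnn [X in (X - _)%N]addnCA addKn -addnA [X in (_ = _ + X)%N]addnC -addnA.
Qed.
End InsertWord.

(** * The recurrence for the generating polynomials *)

Definition alt_poly (R : nzRingType) (b n : nat) : {poly R} :=
  \sum_(p : signed_perm n) 'X^(altdes_from b n (sperm_word p)).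

(** The [d] true indices give ['X^(d.-1)] each, hence the derivative of ['X^d]; the other
    [n - b - d] give ['X^d]. *)
Lemma sum_expX_drop (R : comNzRingType) (b n : nat) (beta : nat -> bool) :
  let d := (\sum_(b <= k < n) beta k)%N in
  \sum_(b <= k < n) 'X^(d - beta k) =
    (1 - 'X) * ('X^d)^`() + (n - b)%:R * 'X^d :> {poly R}.
Proof.
move=> d; have term k : (b <= k < n)%N ->
    'X^(d - beta k) = 'X^d + (beta k : nat)%:R * ((1 - 'X) * 'X^(d.-1)) :> {poly R}.
  move=> /andP[lebk ltkn]; case Ek: (beta k); last by rewrite subn0 mul0r addr0.
  have : (0 < d)%N.
    rewrite /d (@big_cat_nat _ _ _ k) //= ?(ltnW ltkn) //.
    by rewrite [X in (_ + X)%N]big_ltn // Ek addnCA.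
  by case: (d) => // d' _; rewrite subn1 /= exprS; ring.
rewrite (eq_big_nat _ _ term) big_split /= -mulr_suml -natr_sum -/d.
by rewrite sumr_const_nat derivXn -['X^d *+ _]mulr_natl -['X^(d.-1) *+ d]mulr_natl; ring.
Qed.

Lemma sum_insert_max (R : comNzRingType) (b n : nat) (p : signed_perm n) :
  (b <= 1)%N -> (b <= n)%N ->
  let m := 'X^(altdes_from b n (sperm_word p)) : {poly R} in
  \sum_(k < n.+1) \sum_(a : bool)
     'X^(altdes_from b n.+1 (sperm_word (insert_max (k, a, p)))) =
  (1 + 'X ^+ 2) * ((1 - 'X) * m^`() + (n - b)%:R * m) + b.+1%:R * (1 + 'X) * m.
Proof.
move=> leb1 lebn /=; set d := altdes_from b n _.
(* [G k] collects both signs at slot [k]. The end slots are [n] and, when [b = 1], also 0: this is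
   the factor [b.+1]. *)
pose G k : {poly R} := if (k == n) || (k < b)%N then (1 + 'X) * 'X^d
  else (1 + 'X ^+ 2) * 'X^(d - altdesB_at (sperm_word p) k).
rewrite (eq_bigr (fun k : 'I__ => G k)); last first.
  move=> k _; rewrite big_bool /G /=; case: eqP => [ekn | /eqP nekn] /=.
    rewrite !altdes_insert_last // -/d.
    by case: (odd k) => /=; rewrite ?addn0 ?exprD /=; ring.
  have ltkn : (k < n)%N by have := ltn_ord k; lia.
  case: ltnP => [ltkb | lebk].
    have k0 : k = 0 :> nat by lia.
    have b1 : b = 1 by lia.
    rewrite /d b1 !altdes_insert_first //.
    by case: (odd k) => /=; rewrite ?addn0 ?exprD /=; ring.
  rewrite !altdes_insert_mid ?lebk // -/d.
  by case: (odd k) => /=; rewrite ?addn0 ?exprD /=; ring.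
rewrite -(big_mkord xpredT G) big_nat_recr //= (@big_cat_nat _ _ _ b) //=.
rewrite (eq_big_nat _ _ (F2 := fun=> (1 + 'X) * 'X^d)); last first.
  by move=> k /andP[_ ltkb]; rewrite /G ltkb orbT.
rewrite sumr_const_nat subn0 [G n]/G eqxx /=.
rewrite (eq_big_nat _ _ (F2 := fun k => (1 + 'X ^+ 2) *
    'X^(d - altdesB_at (sperm_word p) k))); last first.
  by move=> k /andP[lebk ltkn]; rewrite /G ltn_eqF // ltnNge lebk.
rewrite -mulr_sumr sum_expX_drop -/(altdes_from b n _) -/d -[_ * 'X^d *+ b]mulr_natl; ring.
Qed.

Lemma alt_poly_rec (R : comNzRingType) (b n : nat) : (b <= 1)%N -> (b <= n)%N ->
  let C := alt_poly R b n in
  alt_poly R b n.+1 =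
  (1 + 'X ^+ 2) * ((1 - 'X) * C^`() + (n - b)%:R * C) + b.+1%:R * (1 + 'X) * C.
Proof.
move=> leb1 lebn /=; rewrite /alt_poly.
rewrite (reindex (@insert_max n)) /=; last exact/onW_bij/insert_max_bij.
rewrite linear_sum /= !mulr_sumr -big_split /= !mulr_sumr -big_split /=.
under [RHS]eq_bigr => p _ do rewrite -sum_insert_max // pair_bigA /=.
by rewrite exchange_big /= pair_bigA /=; apply: eq_bigr => -[[k a] p].
Qed.

(** * The cases [b = 0] and [b = 1] *)

Lemma alt_poly0 (R : nzRingType) n : alt_poly R 0 n = hatB R n.
Proof. by []. Qed.

(** Each index is sent to the number of indices with a smaller value. *)
Lemma rank_perm (n : nat) disp (T : orderType disp) (h : 'I_n -> T) :
  injective h -> exists r : 'S_n, forall u v, (r u < r v)%N = (h u < h v)%O.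
Proof.
move=> h_inj; pose below u := [set w | (h w < h u)%O].
have rank_lt u : (#|below u| < n)%N.
  rewrite -[X in (_ < X)%N]card_ord -cardsT; apply: proper_card.
  by apply/properP; split; [exact: subsetT | exists u; rewrite !inE ?ltxx].
pose rank u := Ordinal (rank_lt u).
have rank_mono u v : (h u < h v)%O -> (rank u < rank v)%N.
  move=> ltuv; apply: proper_card; apply/properP; split.
    by apply/subsetP=> w; rewrite !inE => /lt_trans; apply.
  by exists u; rewrite !inE ?ltxx.
have rank_ltE u v : (rank u < rank v)%N = (h u < h v)%O.
  apply/idP/idP=> [|/rank_mono//]; case: (ltgtP (h u) (h v)) => // [ltvu | /h_inj ->].
    by rewrite ltnNge (ltnW (rank_mono _ _ ltvu)).
  by rewrite ltnn.
have rank_inj : injective rank.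
  move=> u v eq_uv; case: (ltgtP (h u) (h v)) => [||/h_inj//];
    by rewrite -rank_ltE eq_uv ltnn.
by exists (perm rank_inj) => u v; rewrite !permE.
Qed.

Lemma nth_perm_word n (s : 'S_n) (i : 'I_n) : nth 0 (perm_word s) i = s i.
Proof. by rewrite (nth_map i) ?size_enum_ord // nth_ord_enum. Qed.

(** Signs attached to values amount to a fixed injective relabelling [h] of the letters; replacing
    it by its rank permutation [r] keeps all comparisons, and [s * r] runs over all permutations. *)
Lemma sum_value_signs (R : nzRingType) n (g : {ffun 'I_n -> bool}) :
  \sum_(s : 'S_n) 'X^(altdes_from 1 n (sperm_word (s, [ffun i => g (s i)])))
  = hatA R n.
Proof.
pose h (v : 'I_n) : int := if g v then - v.+1%:Z else v.+1%:Z.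
have h_inj : injective h.
  by move=> u v; rewrite /h => e; apply: val_inj; move: e => /=;
    case: (g u); case: (g v); lia.
have [r rE] := rank_perm h_inj.
rewrite /hatA [RHS](reindex_inj (mulIg r)) /=.
apply: eq_bigr => s _; congr ('X^_); apply: eq_big_nat => -[|i] // /andP[_ ltin].
have ltin' : (i < n)%N by apply: ltnW.
rewrite /= /altdesB_at.
rewrite (nth_sperm_word _ (Ordinal ltin)) (nth_sperm_word _ (Ordinal ltin')).
rewrite (nth_perm_word _ (Ordinal ltin)) (nth_perm_word _ (Ordinal ltin')).
by rewrite !permM !rE /signed_val !ffunE /= orbC.
Qed.

(* Choosing which values, rather than which positions, are negative makes
   each choice of signs contribute a relabelled copy of the symmetric group. *)
Lemma alt_poly1 (R : nzRingType) n : alt_poly R 1 n = 2 ^+ n * hatA R n.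
Proof.
pose F (s : 'S_n) (e : {ffun 'I_n -> bool}) : {poly R} :=
  'X^(altdes_from 1 n (sperm_word (s, e))).
transitivity (\sum_(s : 'S_n) \sum_(g : {ffun 'I_n -> bool}) F s [ffun i => g (s i)]).
  rewrite /alt_poly (eq_bigr (fun p => F p.1 p.2)); last by case.
  rewrite -(pair_bigA _ F) /=; apply: eq_bigr => s _.
  rewrite (reindex (fun g : {ffun 'I_n -> bool} => [ffun i => g (s i)])) //=.
  exists (fun e : {ffun 'I_n -> bool} => [ffun i => e ((s^-1)%g i)]) => e _;
    by apply/ffunP=> i; rewrite !ffunE ?permK ?permKV.
rewrite exchange_big /= (eq_bigr (fun=> hatA R n)); last first.
  by move=> g _; apply: sum_value_signs.
by rewrite sumr_const card_ffun card_bool card_ord -[LHS]mulr_natl natrX.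
Qed.

(** * The substitution y = (1 + x)/(1 - x) *)

Lemma poly_eq_off1 (R : numFieldType) (p q : {poly R}) :
  (forall x, x != 1 -> p.[x] = q.[x]) -> p = q.
Proof.
move=> eq_pq; apply: subr0_eq.
(* Starting at 2 avoids the excluded point; characteristic 0 keeps these points distinct. *)
pose s : seq R := [seq i%:R | i <- iota 2 (size (p - q))].
have root_s : all (root (p - q)) s.
  apply/allP=> x /mapP[i]; rewrite mem_iota => /andP[lt1i _] ->.
  rewrite rootE !hornerE eq_pq ?subrr //.
  by rewrite -[1]/(1%:R) eqr_nat; lia.
have uniq_s : uniq s by rewrite map_inj_uniq ?iota_uniq // => i j /eqP;
  rewrite eqr_nat => /eqP.
by apply: roots_geq_poly_eq0 root_s uniq_s _; rewrite size_map size_iota.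
Qed.

(** This is the chain rule with dy/dx = 2/(1 - x)^2, proved monomial by monomial because derivatives
    here are formal. *)
Lemma moebius_deriv (R : numFieldType) n (p q : {poly R}) :
  (size q <= n.+1)%N ->
  (forall x, x != 1 -> p.[x] = (1 - x) ^+ n * q.[(1 + x) / (1 - x)]) ->
  forall x, x != 1 ->
    (1 - x) * p^`().[x] + n%:R * p.[x]
    = 2%:R * (1 - x) ^+ n / (1 - x) * q^`().[(1 + x) / (1 - x)].
Proof.
move=> szq ep.
(* The degree-n homogenization of q at (1 + X, 1 - X). *)
pose h := \sum_(i < n.+1) q`_i *: ((1 + 'X) ^+ i * (1 - 'X) ^+ (n - i)).
have hn x i : (i <= n)%N -> x != 1 :> R ->
    (1 + x) ^+ i * (1 - x) ^+ (n - i) = (1 - x) ^+ n * ((1 + x) / (1 - x)) ^+ i.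
  move=> lein nx1; have nz : 1 - x != 0 by rewrite subr_eq0 eq_sym.
  by rewrite -{2}(subnK lein) exprD expr_div_n; field; rewrite expf_neq0.
have qE : q = \sum_(i < n.+1) q`_i *: 'X^i.
  by rewrite -[LHS](coefK q) poly_def (big_ord_widen n.+1 (fun i => q`_i *: 'X^i) szq)
   [LHS]big_mkcond; apply: eq_bigr => i _; case: ltnP => // le_qi;
   rewrite nth_default // scale0r.
have -> : p = h.
  apply: poly_eq_off1 => x nx1; rewrite ep // {1}qE /h !horner_sum mulr_sumr.
  by apply: eq_bigr => i _; rewrite !hornerE /= -[RHS]mulrA hn ?leq_ord //; ring.
move=> x nx1; have nz : 1 - x != 0 by rewrite subr_eq0 eq_sym.
have dp i : ((1 + 'X) ^+ i : {poly R})^`() = i%:R *: (1 + 'X) ^+ i.-1.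
  by rewrite deriv_exp !derivE add0r mul1r scaler_nat.
have dm i : ((1 - 'X) ^+ i : {poly R})^`() = - (i%:R *: (1 - 'X) ^+ i.-1).
  by rewrite deriv_exp !derivE sub0r mulN1r mulNrn scaler_nat.
have dX i : ('X^i : {poly R})^`() = i%:R *: 'X^(i.-1).
  by rewrite derivXn scaler_nat.
rewrite qE /h !linear_sum /= !horner_sum !mulr_sumr -big_split /=.
apply: eq_bigr => -[i /= ltin] _.
rewrite !linearZ /= derivM dp dm dX !hornerE /=.
have /subnK <- : (i <= n)%N by [].
move: (n - i)%N => m; rewrite addnK.
(* The zero exponents are split off because [.-1] is truncated there. *)
case: i m {ltin} => [|i] [|m]; rewrite /= ?expr_div_n ?exprD ?exprS ?expr0 ?natrD;
  by field; rewrite ?nz ?expf_neq0.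
Qed.

(** * Matching with Hoffman's recurrences *)

Lemma size_hoffQ (R : nzRingType) n : (size (hoffQ R n) <= n.+1)%N.
Proof.
elim: n => [|n IH] /=; first by rewrite size_poly1.
have szd : (size (hoffQ R n)^`() <= n)%N.
  by apply: leq_trans (size_poly _ _) _; rewrite -ltnS; case: size IH.
apply: leq_trans (size_polyD _ _) _; rewrite geq_max; apply/andP; split.
  by apply: leq_trans (size_polyMleq _ _) _; rewrite size_polyX.
apply: leq_trans (size_polyMleq _ _) _.
have : (size (1 + 'X ^+ 2 : {poly R})%R <= 3)%N.
  by rewrite addrC -[1]/(1%:P) size_XnaddC.
by move: (size (1 + 'X ^+ 2 : {poly R})%R); lia.
Qed.

Lemma size_hoffP (R : nzRingType) n : (size (hoffP R n) <= n.+2)%N.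
Proof.
elim: n => [|n IH] /=; first by rewrite size_polyX.
have szd : (size (hoffP R n)^`() <= n.+1)%N.
  by apply: leq_trans (size_poly _ _) _; rewrite -ltnS; case: size IH.
apply: leq_trans (size_polyMleq _ _) _.
have : (size (1 + 'X ^+ 2 : {poly R})%R <= 3)%N.
  by rewrite addrC -[1]/(1%:P) size_XnaddC.
by move: (size (1 + 'X ^+ 2 : {poly R})%R); lia.
Qed.

Lemma hatB_hoffQ (R : numFieldType) n (x : R) : x != 1 ->
  (hatB R n).[x] = (1 - x) ^+ n * (hoffQ R n).[(1 + x) / (1 - x)].
Proof.
elim: n x => [|n IH] x nx1.
  rewrite /hatB (eq_bigr (fun=> 1)); last by move=> p _; rewrite /altdesB big_nil.
  by rewrite sumr_const card_prod card_Sn card_ffun card_ord !hornerE.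
have nz : 1 - x != 0 by rewrite subr_eq0 eq_sym.
have := moebius_deriv (size_hoffQ R n) IH nx1.
rewrite -(alt_poly0 R n.+1) alt_poly_rec // alt_poly0 subn0 /=.
rewrite !(hornerE, hornerMn) /= => ->.
rewrite IH // [_ ^+ n.+1]exprS.
move: (hoffQ R n).[_] (hoffQ R n)^`().[_] ((1 - x) ^+ n) => u v w.
(* With y = (1 + x)/(1 - x), this rests on 2(1 + x^2) = (1 - x)^2 (1 + y^2) and 1 + x = (1 - x)
   y. *)
by field.
Qed.

Lemma hatA_hoffP (R : numFieldType) n (x : R) : (0 < n)%N -> x != 1 ->
  2%:R ^+ n * (1 + x ^+ 2) * (hatA R n).[x] =
    (1 - x) ^+ n.+1 * (hoffP R n).[(1 + x) / (1 - x)].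
Proof.
case: n => // n _; pose K n := (1 + 'X ^+ 2) * alt_poly R 1 n.+1.
suff KE y : y != 1 ->
    (K n).[y] = (1 - y) ^+ n.+2 * (hoffP R n.+1).[(1 + y) / (1 - y)].
  move=> nx1; rewrite -KE // /K alt_poly1 !hornerE /=; ring.
elim: n y => [|n IH] y ny1; have nz : 1 - y != 0 by rewrite subr_eq0 eq_sym.
  rewrite /K alt_poly1 /hatA (eq_bigr (fun=> 1)); last first.
    by move=> s _; rewrite /altdes big_geq.
  by rewrite sumr_const card_Sn /= derivX !hornerE /=; field.
have dK := moebius_deriv (size_hoffP R n.+1) IH ny1.
(* The factor 1 + X^2 in [K] absorbs the end-slot term, since (1 - X) 2X + 2(1 + X^2) = 2(1 + X). *)
have KS : K n.+1 = (1 + 'X ^+ 2) * ((1 - 'X) * (K n)^`() + n.+2%:R * K n).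
  rewrite /K alt_poly_rec // !derivE subSS subn0 -[n.+2]addn2 natrD; ring.
have PS : hoffP R n.+2 = (1 + 'X ^+ 2) * (hoffP R n.+1)^`() by [].
rewrite KS PS -polyC_natr [_ ^+ n.+3]exprS.
move: (K n) (hoffP R n.+1) ((1 - y) ^+ n.+2) n.+2%:R dK => L P w c dK.
rewrite !hornerE /= dK; move: (P^`().[_]) => v.
by field.
Qed.

Unset Implicit Arguments.
Set Strict Implicit.

Theorem theorem1p2 (R : numFieldType) (n : nat) (hn : (1 <= n)%N) :
  (forall x : R, x != 1 ->
     2%:R ^+ n * (1 + x ^+ 2) * (hatA R n).[x]
     = (1 - x) ^+ n.+1 * (hoffP R n).[(1 + x) / (1 - x)])
  /\
  (forall x : R, x != 1 ->
     (hatB R n).[x] = (1 - x) ^+ n * (hoffQ R n).[(1 + x) / (1 - x)]).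
Proof.
by split=> x nx1; [exact: hatA_hoffP | exact: hatB_hoffQ].
Qed.
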